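(* Let $\mathbb{F}$ be any field. There is no finite set of equations whose orbit under $\mathrm{SL}_2(\mathbb{F})^n\rtimes S_n$ set-theoretically cuts out the image of the principal minor map for all $n$. That is, there do not exist $N\ge 1$ and a finite set $\mathcal{P}\subset\mathbb{F}[a_S:S\subseteq[N]]$ such that for every $n\geq N$ the following holds: a vector $\mathbf{a}\in\mathbb{F}^{2^n}$ with $a_\emptyset=1$ is the vector of principal minors of some matrix in $\mathbb{F}^{n\times n}$ if and only if $P(\gamma\cdot\mathbf{a})=0$ for all $P\in\mathcal{P}$ and all $\gamma\in\mathrm{SL}_2(\mathbb{F})^n\rtimes S_n$.
   Context: $[n]=\{1,\dots,n\}$. The vector of principal minors of $A\in\mathbb{F}^{n\times n}$ is $(A_S)_{S\subseteq[n]}$, where $A_S$ is the determinant of the submatrix with rows and columns $S$ and $A_\emptyset=1$; the principal minor map sends $A$ to this vector. For $n\geq N$, polynomials in $\mathbb{F}[a_S:S\subseteq[N]]$ are regarded as elements of $\mathbb{F}[a_S:S\subseteq[n]]$ by inclusion. To $\mathbf{a}=(a_S)_{S\subseteq[n]}$ associate $f_{\mathbf{a}}=\sum_{S\subseteq[n]}a_S\prod_{i\in[n]\setminus S}x_i$. The group $\mathrm{SL}_2(\mathbb{F})^n\rtimes S_n$ acts on multiaffine polynomials (degree at most one in each of $x_1,\dots,x_n$): $S_n$ permutes the variables, and $\gamma=(\gamma_i)$ with $\gamma_i=\begin{pmatrix}a_i&b_i\\c_i&d_i\end{pmatrix}$ acts by $\gamma\cdot f=\prod_{i=1}^n(c_ix_i+d_i)\cdot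 f\big(\tfrac{a_1x_1+b_1}{c_1x_1+d_1},\dots,\tfrac{a_nx_n+b_n}{c_nx_n+d_n}\big)$. The action on vectors is defined by $f_{\gamma\cdot\mathbf{a}}=\gamma\cdot f_{\mathbf{a}}$. *)

(* Defs.v *)
From HB Require Import structures.
From mathcomp Require Import all_boot all_order all_algebra all_fingroup.
From mathcomp Require Import mpoly.

Set Implicit Arguments.
Unset Strict Implicit.
Unset Printing Implicit Defensive.

Import GRing.Theory.

Local Open Scope ring_scope.

(* F^(2^n), with coordinates a_S indexed by the subsets S of [n]; [n] is
   'I_n = {0, ..., n-1}. *)
Notation minorvec F n := {ffun {set 'I_n} -> F}.

(* enum_val lists S in increasing order; for S = set0 the determinant is that
   of the 0 x 0 matrix, which is 1. *)
Definition principal_minor (F : fieldType) n (A : 'M[F]_n) (S : {set 'I_n}) : F :=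
  \det (mxsub (@enum_val _ (mem S)) (@enum_val _ (mem S)) A).

Definition principal_minor_map (F : fieldType) n (A : 'M[F]_n) : minorvec F n :=
  [ffun S => principal_minor A S].

(* F[a_S : S \subseteq [n]]; the variable a_S is 'X_(enum_rank S). *)
Notation minorpoly F n := {mpoly F[#|{set 'I_n}|]}.

Definition eval_minorpoly (F : fieldType) n (P : minorpoly F n)
  (a : minorvec F n) : F := P.@[fun k => a (enum_val k)].

Definition widen_set N n (le_N_n : (N <= n)%N) (S : {set 'I_N}) : {set 'I_n} :=
  widen_ord le_N_n @: S.

Definition widen_minorpoly (F : fieldType) N n (le_N_n : (N <= n)%N)
  (P : minorpoly F N) : minorpoly F n :=
  P \mPo [tuple 'X_(enum_rank (widen_set le_N_n (enum_val k))) | k < #|{set 'I_N}|].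

Definition fpoly (F : fieldType) n (a : minorvec F n) : {mpoly F[n]} :=
  \sum_(S : {set 'I_n}) (a S)%:MP * \prod_(i in ~: S) 'X_i.

Definition SL2 (F : fieldType) := {M : 'M[F]_2 | \det M == 1}.

(* The underlying set of the semidirect product SL_2(F)^n x| S_n: every element
   is uniquely a product g s with g in SL_2(F)^n and s in S_n, so only the
   action of such a product is needed to describe orbits. *)
Definition SL2wr (F : fieldType) n := ({ffun 'I_n -> SL2 F} * 'S_n)%type.

Section Action.
Variables (F : fieldType) (n : nat).
Implicit Types (f : {mpoly F[n]}) (a : minorvec F n) (gam : SL2wr F n).

(* For M = [a b; c d]: the linear forms a x_i + b (r = 0) and c x_i + d (r = 1). *)
Definition linform (M : 'M[F]_2) (i : 'I_n) (r : 'I_2) : {mpoly F[n]} :=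
  (M r 0)%:MP * 'X_i + (M r 1)%:MP.

(* \prod_i (c_i x_i + d_i) * f(.., (a_i x_i + b_i) / (c_i x_i + d_i), ..),
   computed in the field of rational functions F(x_1, .., x_n). *)
Definition moebius (g : {ffun 'I_n -> SL2 F}) f : {fraction {mpoly F[n]}} :=
  (\prod_i tofrac (linform (val (g i)) i 1)) *
  mmap (@tofrac {mpoly F[n]} \o @mpolyC n F)
       (fun i => tofrac (linform (val (g i)) i 0) / tofrac (linform (val (g i)) i 1))
       f.

Definition SL2wr_poly gam f : {fraction {mpoly F[n]}} := moebius gam.1 (msym gam.2 f).

Lemma linform1_neq0 (M : SL2 F) i : tofrac (linform (val M) i 1) != 0.
Proof.
case: M => M /= /eqP; rewrite tofrac_eq0 => detM.
apply/eqP => /mpolyP M0; have := M0 U_(i)%MM; have := M0 0%MM.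
rewrite /linform !mcoeffD !mcoeffCM !mcoeffC mcoeffXU mcoeffX !eqxx mnm1_eq0.
rewrite !mulr0 !mulr1 add0r addr0 => d0 c0.
move/eqP: detM; rewrite (expand_det_row _ 1) !big_ord_recl big_ord0 /=.
have -> : lift ord0 ord0 = 1 :> 'I_2 by apply: val_inj.
by rewrite c0 d0 !mul0r !addr0 eq_sym oner_eq0.
Qed.

Lemma prod_setC_mpolyX (S : {set 'I_n}) :
  \prod_(i in ~: S) 'X_i = 'X_[[multinom (i \notin S : nat) | i < n]]
  :> {mpoly F[n]}.
Proof.
rewrite mpolyXE_id big_mkcond; apply: eq_bigr => i _.
by rewrite mnmE inE; case: (i \in S); rewrite ?expr1 ?expr0.
Qed.

Lemma mcoeff_fpoly a (S : {set 'I_n}) :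
  (fpoly a)@_[multinom (i \notin S : nat) | i < n] = a S.
Proof.
rewrite /fpoly raddf_sum (bigD1 S) //= [X in _ + X]big1 ?addr0 => [|T neqTS].
  by rewrite prod_setC_mpolyX mcoeffCM mcoeffX eqxx mulr1.
rewrite prod_setC_mpolyX mcoeffCM mcoeffX.
case: eqP => [/mnmP eqST|]; rewrite ?mulr0 //.
case/eqP: neqTS; apply/setP => i; have := eqST i; rewrite !mnmE.
by do 2!case: (_ \in _).
Qed.

Lemma fpoly_inj : injective (@fpoly F n).
Proof. by move=> a b eq_ab; apply/ffunP => S; rewrite -!mcoeff_fpoly eq_ab. Qed.

Definition perm_minorvec (s : 'S_n) a : minorvec F n :=
  [ffun S : {set 'I_n} => a (s^-1%g @: S)].

Lemma msym_fpoly (s : 'S_n) a : msym s (fpoly a) = fpoly (perm_minorvec s a).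
Proof.
rewrite /fpoly raddf_sum /= (reindex_inj (imset_inj (@perm_inj _ s^-1%g))) /=.
apply: eq_bigr => S _; rewrite ffunE rmorphM /= /msym mmapC rmorph_prod /=.
congr (_ * _); rewrite (reindex_inj (@perm_inj _ s^-1%g)) /=.
apply: eq_big => i; first by rewrite !inE mem_imset //; apply: perm_inj.
by move=> _; rewrite mmapX mmap1U permKV.
Qed.

Definition moebius_minorvec (g : {ffun 'I_n -> SL2 F}) a : minorvec F n :=
  [ffun T : {set 'I_n} => \sum_(S : {set 'I_n})
     a S * \prod_i val (g i) (if i \in S then 1 else 0) (if i \in T then 1 else 0)].

Lemma moebius_fpoly g a :
  moebius g (fpoly a) = tofrac (fpoly (moebius_minorvec g a)).
Proof.
rewrite /moebius; set h := (X in mmap _ X).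
pose fC : {rmorphism F -> {fraction {mpoly F[n]}}} :=
  (@tofrac {mpoly F[n]} \o @mpolyC n F).
have expand (S : {set 'I_n}) :
    (\prod_i tofrac (linform (val (g i)) i 1)) * \prod_(i in ~: S) h i =
    tofrac (\sum_(T : {set 'I_n}) (\prod_i val (g i)
      (if i \in S then 1 else 0) (if i \in T then 1 else 0))%:MP
      * \prod_(i in ~: T) 'X_i).
  rewrite [X in _ * X]big_mkcond -big_split /=.
  transitivity (tofrac (\prod_i
    ((val (g i) (if i \in S then 1 else 0) 1)%:MP +
     (val (g i) (if i \in S then 1 else 0) 0)%:MP * 'X_i))).
    rewrite rmorph_prod; apply: eq_bigr => i _ /=.
    rewrite inE addrC; case: (i \in S); rewrite /= ?mulr1 //.
    by rewrite /h mulrC divfK // linform1_neq0.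
  rewrite bigA_distr; congr (tofrac _); apply: eq_bigr => T _.
  rewrite rmorph_prod [X in _ * X]big_mkcond -big_split /=.
  by apply: eq_bigr => i _; rewrite inE; case: (i \in T); rewrite ?mulr1.
transitivity (tofrac (\sum_(S : {set 'I_n}) \sum_(T : {set 'I_n}) (a S)%:MP *
    ((\prod_i val (g i) (if i \in S then 1 else 0)
       (if i \in T then 1 else 0))%:MP * \prod_(i in ~: T) 'X_i))).
  rewrite -[_ \o _]/(fC : F -> _) /fpoly [mmap _ _ _]raddf_sum mulr_sumr /=.
  rewrite raddf_sum; apply: eq_bigr => S _ /=.
  rewrite rmorphM /= mmapC rmorph_prod /= mulrCA.
  under [X in _ * (_ * X)]eq_bigr => i _ do rewrite mmapX mmap1U.
  by rewrite expand -tofracM mulr_sumr.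
rewrite exchange_big /fpoly; congr (tofrac _); apply: eq_bigr => T _.
rewrite ffunE raddf_sum /= mulr_suml.
by apply: eq_bigr => S _; rewrite rmorphM /= mulrA.
Qed.

Lemma SL2wr_act_ex gam a :
  exists b, tofrac (fpoly b) == SL2wr_poly gam (fpoly a).
Proof.
exists (moebius_minorvec gam.1 (perm_minorvec gam.2 a)).
by rewrite /SL2wr_poly msym_fpoly moebius_fpoly.
Qed.

(* gam . a, the unique vector with f_(gam . a) = gam . f_a; see SL2wr_actP
   and fpoly_inj. *)
Definition SL2wr_act gam a : minorvec F n := xchoose (SL2wr_act_ex gam a).

Lemma SL2wr_actP gam a :
  tofrac (fpoly (SL2wr_act gam a)) = SL2wr_poly gam (fpoly a).
Proof. exact/eqP/(xchooseP (SL2wr_act_ex gam a)). Qed.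

End Action.

(* Main.v *)
Require Import Defs.
From mathcomp Require Import all_boot all_order all_algebra all_fingroup.
From mathcomp Require Import mpoly ring.

Set Implicit Arguments.
Unset Strict Implicit.
Unset Printing Implicit Defensive.

Import GRing.Theory.

Local Open Scope ring_scope.

(** Write a vector a homogeneously, as the multilinear form
        hev a (x, y) = sum_S a_S prod_(i in S) y_i prod_(i notin S) x_i .
    Acting by SL_2^n and reading only the coordinates indexed by subsets of
    [N] amounts to putting an F-rational point of P^1 in each of the n - N
    remaining variables.  So finitely many equations in F[a_S : S in [N]] see
    only such specializations of a, and it suffices to produce, for each N, a
    vector that is not a vector of principal minors although all its
    specializations to N variables occur among the specializations of vectors
    of principal minors.

    The vector is [twisted_cycle].  Take an even cycle
    l_0 r_0 l_1 r_1 .. l_(K-1) r_(K-1), with K odd, and a last variable, the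
    hub.  With the coupling [i j] = x_i x_j + y_i y_j on the edges, the form is
        x_hub prod_e [l_e r_e] + y_hub prod_e [l_e r_(e-1)] ,
    a pencil spanned by the two perfect matchings of the cycle.

    It is not determinantal ([twisted_cycle_not_principal_minors]).  If it were
    det (diag x + diag y A), the Pluecker relation [plucker_replace_rows] in
    the two slots l_0 and hub would factor the associated 2 x 2 determinant of
    coefficients as G H, with G and H themselves determinants, hence affine in
    every remaining variable.  In suitable coordinates this 2 x 2 determinant
    is a product of differences w_i - w_j along the cycle that is left once l_0
    is contracted, of ODD length 2K - 1.  Each factor w_i - w_j divides G or H,
    but neither G nor H can be divisible by two factors sharing a variable.
    This would 2-colour the edges of an odd cycle ([odd_cycle_not_split]).

    Specializing a single l_e repairs the defect
    ([twisted_cycle_contraction]).  The determinant of the K x K matrix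
    carrying the couplings [l_i r_j] on a cyclic band, with weights s on the
    diagonal and t next to it, is prod s prod [l_e r_e] + prod t
    prod [l_e r_(e-1)] ([det_cyclic_bidiagonal]; K odd makes the sign +), and
    it unfolds into a 2K x 2K determinant whose rows are linear in one vertex
    each.  Once the point at l_e is constant, its row is free to carry the hub,
    as the weights (s, t) = (x_hub, y_hub).  When K > N some l_e must be
    specialized, and every form det (diag x B + diag y C) is equivalent to
    principal minors as far as the coordinates in [N] can tell
    ([principal_minor_map_orbit_of_mixed_minors]). *)

(** * Homogeneous forms and determinantal pencils *)

Section Pencils.
Variables (F : fieldType) (n : nat).

(** The maximal minors of [B | C] that pick one of the two i-th rows for each
    i: these are the coefficients of det (diag x B + diag y C). *)
Definition mixed_minors (B C : 'M[F]_n) : minorvec F n :=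
  [ffun S : {set 'I_n} => \det (\matrix_(i, j) (if i \in S then C i j else B i j))].

Section Eval.
Variables (R : comNzRingType) (phi : {rmorphism F -> R}).

(** The homogenization of [fpoly a], evaluated in an F-algebra; polynomial
    arguments are needed as well as points over F. *)
Definition hev (a : minorvec F n) (x y : 'I_n -> R) : R :=
  \sum_(S : {set 'I_n}) phi (a S) * \prod_i (if i \in S then y i else x i).

Definition pencil (B C : 'M[F]_n) (x y : 'I_n -> R) : 'M[R]_n :=
  \matrix_(i, j) (x i * phi (B i j) + y i * phi (C i j)).

Lemma hevD a b x y : hev (a + b) x y = hev a x y + hev b x y.
Proof.
by rewrite -big_split; apply: eq_bigr => S _; rewrite ffunE rmorphD mulrDl.
Qed.

Lemma hev_mixed_minors B C x y :
  hev (mixed_minors B C) x y = \det (pencil B C x y).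
Proof.
rewrite /hev /determinant.
under eq_bigr => S _ do rewrite ffunE /determinant rmorph_sum mulr_suml.
rewrite exchange_big; apply: eq_bigr => s _ /=.
under [in RHS]eq_bigr => i _ do rewrite mxE addrC.
rewrite bigA_distr mulr_sumr; apply: eq_bigr => S _.
rewrite rmorphM rmorph_sign -mulrA rmorph_prod -big_split /=.
by congr (_ * _); apply: eq_bigr => i _; rewrite mxE mulrC; case: ifP.
Qed.

Lemma hevZ (c x y : 'I_n -> R) a :
  hev a (fun i => c i * x i) (fun i => c i * y i) = (\prod_i c i) * hev a x y.
Proof.
rewrite /hev mulr_sumr; apply: eq_bigr => S _; rewrite mulrCA -big_split /=.
by congr (_ * _); apply: eq_bigr => i _; case: ifP.
Qed.

Lemma eq_hev a x x' y y' : x =1 x' -> y =1 y' -> hev a x y = hev a x' y'.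
Proof.
move=> ex ey; apply: eq_bigr => S _; congr (_ * _); apply: eq_bigr => i _.
by rewrite ex ey.
Qed.

End Eval.

Lemma hev_set0 (a : minorvec F n) :
  a set0 = hev idfun a (fun=> 1) (fun=> 0).
Proof.
rewrite /hev (bigD1 set0) //= big1 => [|i _]; last by rewrite inE.
rewrite mulr1 big1 ?addr0 // => S /set0Pn[i iS].
by rewrite (bigD1 i) //= iS mul0r mulr0.
Qed.

End Pencils.

Lemma det_mxsub_bij (R : comNzRingType) m n (f : 'I_m -> 'I_n) (A : 'M[R]_n) :
  m = n -> injective f -> \det (mxsub f f A) = \det A.
Proof.
move=> e; case: n / e f A => f A fI.
have -> : mxsub f f A = row_perm (perm fI) (col_perm (perm fI) A).
  by apply/matrixP => i j; rewrite !mxE !permE.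
rewrite row_permE col_permE !det_mulmx !det_perm mulrCA.
by rewrite odd_permV -signr_addb addbb mulr1.
Qed.

(** Listing first the indices in S, then the others, makes the matrix with
    rows of A on S and unit rows elsewhere block triangular. *)
Lemma principal_minorE (F : fieldType) n (A : 'M[F]_n) :
  principal_minor_map A = mixed_minors 1%:M A.
Proof.
apply/ffunP => S; rewrite !ffunE /principal_minor.
set M := (X in _ = \det X).
pose f (i : 'I_(#|S| + #|~: S|)) : 'I_n :=
  match split i with inl j => enum_val j | inr j => enum_val j end.
have fI : injective f.
  move=> i j; rewrite /f; case: splitP => k ek; case: splitP => l el.
  - by move/enum_val_inj => e; apply: val_inj; rewrite /= ek el e.
  - move=> e; have := enum_valP k; rewrite e.
    by have := enum_valP l; rewrite inE => /negP.
  - move=> e; have := enum_valP l; rewrite -e.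
    by have := enum_valP k; rewrite inE => /negP.
  - by move/enum_val_inj => e; apply: val_inj; rewrite /= ek el e.
have sz : (#|S| + #|~: S| = n)%N by rewrite cardsC card_ord.
rewrite -(det_mxsub_bij M sz fI) -[mxsub f f M]submxK.
have -> : dlsubmx (mxsub f f M) = 0.
  apply/matrixP => i j; rewrite !mxE /f.
  rewrite -[rshift _ i]/(unsplit (inr i)) -[lshift _ j]/(unsplit (inl j)) !unsplitK.
  have := enum_valP i; have := enum_valP j; rewrite inE => jS iS.
  rewrite (negPf iS); case: eqP => // e; by rewrite e jS in iS.
rewrite det_ublock.
have -> : drsubmx (mxsub f f M) = 1%:M.
  apply/matrixP => i j; rewrite !mxE /f.
  rewrite -[rshift _ _]/(unsplit (inr i)) -[rshift _ j]/(unsplit (inr j)) !unsplitK.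
  have := enum_valP i; rewrite inE => /negPf ->.
  by rewrite (inj_eq enum_val_inj).
rewrite det1 mulr1; congr (\det _); apply/matrixP => i j; rewrite !mxE /f.
rewrite -[lshift _ i]/(unsplit (inl i)) -[lshift _ j]/(unsplit (inl j)) !unsplitK.
by rewrite (enum_valP i).
Qed.

Section OrbitE.
Variables (F : fieldType) (n : nat).
Implicit Types (a : minorvec F n) (gam : SL2wr F n).

(** Explicit form of the action: coordinate T of gam . a evaluates the form of
    a at columns of the matrices in gam.  An index outside T contributes the
    first column, which is where the specialization picture comes from. *)
Lemma SL2wr_actE gam a :
  SL2wr_act gam a = [ffun T : {set 'I_n} =>
    hev idfun a (fun i => val (gam.1 (gam.2 i)) 0 (if gam.2 i \in T then 1 else 0))
                (fun i => val (gam.1 (gam.2 i)) 1 (if gam.2 i \in T then 1 else 0))].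
Proof.
have -> : SL2wr_act gam a = moebius_minorvec gam.1 (perm_minorvec gam.2 a).
  apply/fpoly_inj/eqP; rewrite -tofrac_eq SL2wr_actP /SL2wr_poly.
  by rewrite msym_fpoly moebius_fpoly.
apply/ffunP => T; rewrite !ffunE (reindex_inj (imset_inj (@perm_inj _ gam.2))) /=.
apply: eq_bigr => S _; rewrite ffunE.
have -> : (gam.2^-1)%g @: (gam.2 @: S) = S.
  by rewrite -imset_comp (eq_imset (g := id)) ?imset_id // => i; rewrite /= permK.
congr (_ * _); rewrite (reindex_inj (@perm_inj _ gam.2)) /=.
apply: eq_bigr => i _; rewrite mem_imset; last exact: perm_inj.
by case: ifP.
Qed.

End OrbitE.

(** * Determinantal forms in the orbit of principal minors *)

Lemma det_mx22 (R : comNzRingType) (A : 'M[R]_2) :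
  \det A = A 0 0 * A 1 1 - A 0 1 * A 1 0.
Proof.
rewrite (expand_det_row _ 0) !big_ord_recl big_ord0 /cofactor !det_mx11 !mxE.
have -> : lift ord0 ord0 = 1 :> 'I_2 by apply: val_inj.
have -> : lift 1 0 = 0 :> 'I_2 by apply: val_inj.
by rewrite expr0 expr1 mul1r mulN1r mulrN addr0.
Qed.

(** Multiplication by diag(d, 1/d) on the right and, if b holds, by a quarter
    turn on the left.  The first column, the only one read at a specialized
    index, can thus be scaled by any nonzero d. *)
Lemma SL2_quarter_turn_scale (F : fieldType) (g : SL2 F) (b : bool) (d : F) :
  d != 0 -> exists h : SL2 F, forall c : bool,
    let sc := if c then d^-1 else d in let j : 'I_2 := if c then 1 else 0 in
    val h 0 j = sc * (if b then val g 1 j else val g 0 j) /\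
    val h 1 j = sc * (if b then - val g 0 j else val g 1 j).
Proof.
move=> d0; pose h : 'M[F]_2 := \matrix_(i, j)
  ((if j == 0 then d else d^-1) *
   (if b then (if i == 0 then val g 1 j else - val g 0 j) else val g i j)).
have dh : \det h == 1.
  rewrite -(eqP (valP g)) !det_mx22 !mxE /=.
  by case: (b); apply/eqP; field.
by exists (Sub h dh) => -[] /=; rewrite !mxE /=; case: (b).
Qed.

Lemma notin_widen_set N n (le_N_n : (N <= n)%N) (T : {set 'I_N}) (i : 'I_n) :
  (N <= i)%N -> i \notin widen_set le_N_n T.
Proof.
move=> Ni; apply/negP => /imsetP[j _ ij]; have := ltn_ord j.
by rewrite ltnNge -[j : nat]/(widen_ord le_N_n j : nat) -ij Ni.
Qed.

(** Exchanging x_i and y_i (up to sign) on a set S of indices where the minor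
    of [B | C] is some d != 0 makes B invertible, and then
    det (diag x B + diag y C) = d det (diag x + diag y (C B^-1)).  The scalar d
    is absorbed by the specialized index i0, whose point has a free scale. *)
Lemma principal_minor_map_orbit_of_mixed_minors (F : fieldType) N n
    (le_N_n : (N <= n)%N) (B C : 'M[F]_n) (gam : SL2wr F n) (i0 : 'I_n) :
  (N <= gam.2 i0)%N ->
  exists (A : 'M[F]_n) (gam' : SL2wr F n), forall T : {set 'I_N},
    SL2wr_act gam (mixed_minors B C) (widen_set le_N_n T) =
    SL2wr_act gam' (principal_minor_map A) (widen_set le_N_n T).
Proof.
move=> Ni0. case: (pickP (fun S => mixed_minors B C S != 0)) => [S|BC0]; last first.
  (* All minors vanish: obtain 0 from the form prod_i x_i of the zero matrix,
     by specializing the index of i0 to a point with x = 0. *)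
  have one_SL2 : \det (1%:M : 'M[F]_2) == 1 by rewrite det1.
  have [h hP] := SL2_quarter_turn_scale (exist _ 1%:M one_SL2 : SL2 F) true (oner_neq0 F).
  exists 0, ([ffun=> h], 1%g) => T; rewrite !SL2wr_actE !ffunE principal_minorE.
  rewrite [LHS]big1 => [|S _]; last first.
    by rewrite [mixed_minors _ _ S](eqP (negbFE (BC0 S))) mul0r.
  rewrite hev_mixed_minors (_ : pencil _ _ _ _ _ = diag_mx
     (\row_i val h 0 (if i \in widen_set le_N_n T then 1 else 0))).
    rewrite det_diag (bigD1 (gam.2 i0)) //= mxE.
    rewrite (negPf (notin_widen_set _ _ Ni0)); have /= [-> _] := hP false.
    by rewrite mxE /= mulr0 mul0r.
  by apply/matrixP => i j; rewrite !mxE /= perm1 !ffunE mulr0 addr0 mulr_natr.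
rewrite ffunE; set B' := \matrix_(i, j) _ => d0; set d := \det B' in d0.
pose C' : 'M_n := \matrix_(i, j) (if i \in S then - B i j else C i j).
pose A := C' *m invmx B'.
have B'u : B' \in unitmx by rewrite unitmxE unitfE.
pose sc i := if i == i0 then d else 1.
have /fin_all_exists[h hP] : forall i : 'I_n, exists h : SL2 F, forall c : bool,
    let s := if c then (sc i)^-1 else sc i in let j : 'I_2 := if c then 1 else 0 in
    val h 0 j = s * (if i \in S then val (gam.1 (gam.2 i)) 1 j
                     else val (gam.1 (gam.2 i)) 0 j) /\
    val h 1 j = s * (if i \in S then - val (gam.1 (gam.2 i)) 0 j
                     else val (gam.1 (gam.2 i)) 1 j).
  move=> i; apply: SL2_quarter_turn_scale; rewrite /sc; case: ifP => // _.
  exact: oner_neq0.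
exists A, ([ffun i => h ((gam.2)^-1%g i)], gam.2) => T.
rewrite !SL2wr_actE !ffunE /= principal_minorE.
set x := (X in hev _ _ X _ = _); set y := (X in hev _ _ _ X = _).
pose x' i := if i \in S then y i else x i.
pose y' i := if i \in S then - x i else y i.
rewrite [RHS](@eq_hev F n F idfun _ _ (fun i => sc i * x' i)
  _ (fun i => sc i * y' i)); first last.
- move=> i; rewrite ffunE permK /sc; have := hP i (gam.2 i \in widen_set le_N_n T).
  case: ifP => iT; case=> _ ->; rewrite /x' /y' /x /y iT //.
  rewrite /sc; case: eqP => [e|_]; last by rewrite invr1.
  by rewrite e (negPf (notin_widen_set _ _ Ni0)) in iT.
- move=> i; rewrite ffunE permK /sc; have := hP i (gam.2 i \in widen_set le_N_n T).
  case: ifP => iT; case=> -> _; rewrite /x' /y' /x /y iT //.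
  rewrite /sc; case: eqP => [e|_]; last by rewrite invr1.
  by rewrite e (negPf (notin_widen_set _ _ Ni0)) in iT.
rewrite hevZ (bigD1 i0) //= big1 ?mulr1 => [|i /negPf]; last by rewrite /sc => ->.
rewrite /sc eqxx !hev_mixed_minors mulrC -det_mulmx; congr (\det _).
have -> : pencil idfun 1%:M A x' y' = diag_mx (\row_i x' i) + diag_mx (\row_i y' i) *m A.
  by apply/matrixP => i j; rewrite mul_diag_mx !mxE /= mulr_natr.
rewrite mulmxDl -!mulmxA mulVmx // mulmx1.
apply/matrixP => i j; rewrite !mul_diag_mx !mxE /x' /y' /=.
by case: ifP => _; rewrite // mulrNN addrC.
Qed.

(** * The determinant of a cyclic band *)

(** Over a ring where det D may be a zero divisor, replace D by D + X over the
    polynomial ring: its determinant is monic, hence regular, so it cancels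
    from the block-triangularization; then put X = 0. *)
Lemma det_block_comm (R : comNzRingType) n (A B C D : 'M[R]_n) :
  C *m D = D *m C -> \det (block_mx A B C D) = \det (A *m D - B *m C).
Proof.
move=> cCD; pose P M := map_mx (@polyC R) M.
pose DX : 'M[{poly R}]_n := 'X%:M + P n n D.
have mon : \det DX \is monic.
  rewrite /DX; have -> : P n n D = - P n n (- D) by rewrite /P map_mxN opprK.
  exact: char_poly_monic.
have key : \det (block_mx (P n n A) (P n n B) (P n n C) DX) =
           \det (P n n A *m DX - P n n B *m P n n C).
  have cCDX : P n n C *m DX = DX *m P n n C.
    by rewrite /DX mulmxDl mulmxDr -!map_mxM cCD scalar_mxC.
  apply: (monic_rreg mon) => /=.
  pose E := block_mx DX 0 (- P n n C) 1%:M.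
  have -> : \det DX = \det E by rewrite det_lblock det1 mulr1.
  rewrite -det_mulmx mulmx_block !mulmx0 !mulmx1 !add0r !mulmxN cCDX subrr.
  by rewrite det_ublock det_lblock det1 mulr1.
have := congr1 (horner_eval 0) key; rewrite -!det_map_mx map_block_mx.
rewrite map_mxB !map_mxM.
have PK M : map_mx (horner_eval 0) (P n n M) = M.
  by apply/matrixP => i j; rewrite !mxE /= /horner_eval hornerC.
by rewrite !PK /DX map_mxD PK map_scalar_mx /= /horner_eval hornerX raddf0 add0r.
Qed.

(** Only the identity and the K-cycle contribute, and the cycle is an even
    permutation as the size K = k + 2 is odd.  Expanding along the first row
    leaves two triangular minors. *)
Lemma det_cyclic_bidiagonal (R : comNzRingType) k (a b : 'I_k.+2 -> R) :
  ~~ odd k.+1 ->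
  \det (\matrix_(i, j) (a i *+ (j == i) + b i *+ (j == ord_pred i))) =
  \prod_i a i + \prod_i b i.
Proof.
move=> kodd; set M := (X in \det X).
have predL (i : 'I_k.+1) (j : 'I_k.+2) :
    (j == ord_pred (lift ord0 i)) = (j == i :> nat).
  rewrite -val_eqE /= /bump /= add0n modnDr modn_small //.
  by case: i => i /= /ltnW.
have pred0 (j : 'I_k.+2) : (j == ord_pred ord0) = (j == k.+1 :> nat).
  by rewrite -val_eqE /= modn_small.
rewrite (expand_det_row _ ord0) (bigD1 ord0) //= (bigD1 ord_max) //= big1 ?addr0 => [|j].
  congr (_ + _).
    rewrite !mxE pred0 /= addr0 /cofactor expr0 mul1r det_trig.
      rewrite [in RHS]big_ord_recl; congr (_ * _); apply: eq_bigr => i _.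
      by rewrite !mxE eqxx predL /= /bump add1n (gtn_eqF (ltnSn i)) addr0.
    apply/is_trig_mxP => i j ij; rewrite !mxE predL -val_eqE /=.
    rewrite /bump !add1n eqSS (gtn_eqF ij) add0r.
    by rewrite gtn_eqF ?(leqW ij).
  rewrite !mxE pred0 /= eqxx add0r /cofactor /=.
  rewrite -signr_odd add0n (negPf kodd) expr0 mul1r -det_tr det_trig.
    rewrite [in RHS]big_ord_recl; congr (_ * _); apply: eq_bigr => i _.
    rewrite !mxE predL -val_eqE /= /bump !add1n.
    by rewrite leqNgt ltn_ord /= add0n eqxx ltn_eqF // add0r.
  apply/is_trig_mxP => i j ij; rewrite !mxE predL -val_eqE /=.
  rewrite /bump leqNgt ltn_ord add1n !add0n (ltn_eqF ij) addr0.
  by rewrite ltn_eqF // (leqW ij).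
case/andP => j0 jm; rewrite !mxE (negPf j0) pred0.
by rewrite -val_eqE /= in jm; rewrite (negPf jm) addr0 mul0r.
Qed.

(** * The twisted cycle and its contractions *)

Section Vertices.
Variable k : nat.
Definition lvert (e : 'I_k) : 'I_(k + k + 1) := lshift 1 (lshift k e).
Definition rvert (e : 'I_k) : 'I_(k + k + 1) := lshift 1 (rshift k e).
Definition hub : 'I_(k + k + 1) := rshift (k + k) ord0.

Lemma lvert_inj : injective lvert.
Proof. by move=> i j /lshift_inj/lshift_inj. Qed.

Lemma rvert_inj : injective rvert.
Proof. by move=> i j /lshift_inj/rshift_inj. Qed.

Lemma lvert_hub e : (lvert e == hub) = false.
Proof. exact: eq_lrshift. Qed.

Lemma rvert_hub e : (rvert e == hub) = false.
Proof. exact: eq_lrshift. Qed.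

Lemma lvert_rvert e e' : (lvert e == rvert e') = false.
Proof. by rewrite /lvert /rvert (inj_eq (@lshift_inj _ _)) eq_lrshift. Qed.

Lemma vert_ind (P : 'I_(k + k + 1) -> Prop) :
  (forall e, P (lvert e)) -> (forall e, P (rvert e)) -> P hub -> forall i, P i.
Proof.
move=> Pl Pr Ph i; case: (split_ordP i) => j ->; last by rewrite ord1.
by case: (split_ordP j) => e ->; [apply: Pl | apply: Pr].
Qed.

End Vertices.

Section Gadget.
Variables (R : comNzRingType) (k : nat).

Definition cyclic_band (s t : 'I_k -> R) : 'M[R]_k :=
  \matrix_(i, j) (s i *+ (j == i) + t i *+ (j == ord_pred i)).

Definition coupling (x y : 'I_(k + k + 1) -> R) (i j : 'I_k) : R :=
  x (lvert i) * x (rvert j) + y (lvert i) * y (rvert j).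

(** The unfolded form of the K x K matrix of couplings weighted by W: each row
    of the first two block rows involves a single vertex. *)
Definition cycle_mx (W : 'M[R]_k) (x y : 'I_(k + k + 1) -> R) (c : R) :=
  block_mx
    (block_mx (\matrix_(i, j) (x (lvert i) * W i j))
              (\matrix_(i, j) (y (lvert i) * W i j))
              (- diag_mx (\row_i y (rvert i)))
              (diag_mx (\row_i x (rvert i)))) 0 0 (c%:M : 'M_1).

Lemma det_cycle_mx W x y c :
  \det (cycle_mx W x y c) = \det (\matrix_(i, j) (W i j * coupling x y i j)) * c.
Proof.
rewrite det_lblock det_scalar1 det_block_comm; last first.
  by rewrite mulNmx mulmxN diag_mxC.
congr (\det _ * c); apply/matrixP => i j.
by rewrite mulmxN opprK !mul_mx_diag !mxE /coupling; ring.
Qed.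

End Gadget.

Lemma det_cycle_mx_band (R : comNzRingType) k (s t : 'I_k.+2 -> R)
    (x y : 'I_(k.+2 + k.+2 + 1) -> R) c : ~~ odd k.+1 ->
  \det (cycle_mx (cyclic_band s t) x y c) =
  ((\prod_i s i) * (\prod_i coupling x y i i) +
   (\prod_i t i) * \prod_i coupling x y i (ord_pred i)) * c.
Proof.
move=> ko; rewrite det_cycle_mx -!big_split -det_cyclic_bidiagonal //=.
congr (\det _ * c); apply/matrixP => i j; rewrite !mxE mulrDl !mulrnAl.
by congr (_ + _); case: eqP => [->|].
Qed.

Section TwistedCycle.
Variables (F : fieldType) (k : nat).
Hypothesis k_even : ~~ odd k.+1.
Notation K := k.+2.
Notation n := (K + K + 1)%N.

(** The coefficients B and C such that diag x B + diag y C is [cycle_mx W],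
    with x_hub p + y_hub q in the corner. *)
Definition vertex_const_mx (W : 'M[F]_K) (p : F) : 'M[F]_n :=
  block_mx (block_mx W 0 0 1%:M) 0 0 p%:M.
Definition vertex_linear_mx (W : 'M[F]_K) (q : F) : 'M[F]_n :=
  block_mx (block_mx 0 W (- 1%:M) 0) 0 0 q%:M.

(** The sum of the forms of the two matchings: each of them alone is
    determinantal, with the hub as an isolated vertex. *)
Definition twisted_cycle : minorvec F n :=
  mixed_minors (vertex_const_mx (cyclic_band (fun=> 1) (fun=> 0)) 1)
               (vertex_linear_mx (cyclic_band (fun=> 1) (fun=> 0)) 0) +
  mixed_minors (vertex_const_mx (cyclic_band (fun=> 0) (fun=> 1)) 0)
               (vertex_linear_mx (cyclic_band (fun=> 0) (fun=> 1)) 1).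

Lemma pencil_vertex_mx (R : comNzRingType) (phi : {rmorphism F -> R}) W p q x y :
  pencil phi (vertex_const_mx W p) (vertex_linear_mx W q) x y =
  cycle_mx (map_mx phi W) x y (x (hub K) * phi p + y (hub K) * phi q).
Proof.
have phiE (b : bool) : phi b%:R = b%:R by rewrite rmorph_nat.
apply/matrixP => i j; rewrite mxE /vertex_const_mx /vertex_linear_mx /cycle_mx.
elim/vert_ind: i => [i|i|]; elim/vert_ind: j => [j|j|];
  rewrite ?block_mxEul ?block_mxEur ?block_mxEdl ?block_mxEdr;
  rewrite ?block_mxEul ?block_mxEur ?block_mxEdl ?block_mxEdr !mxE
    ?rmorph0 ?mulr0 ?addr0 ?add0r ?rmorphN /= ?phiE ?mulrN ?mulr_natr //.
Qed.

Lemma hev_twisted_cycle (R : comNzRingType) (phi : {rmorphism F -> R}) x y :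
  hev phi twisted_cycle x y =
  x (hub K) * \prod_i coupling x y i i +
  y (hub K) * \prod_i coupling x y i (ord_pred i).
Proof.
have bandE (s t : F) :
    map_mx phi (cyclic_band (fun=> s) (fun=> t)) =
    cyclic_band (fun=> phi s) (fun=> phi t) :> 'M_K.
  by apply/matrixP => i j; rewrite !mxE rmorphD !rmorphMn.
rewrite hevD !hev_mixed_minors !pencil_vertex_mx !bandE !det_cycle_mx_band //.
rewrite !rmorph0 !rmorph1 !big1_eq !mulr1 !mulr0 !addr0 !add0r.
rewrite !(big_ord_recl k.+1 (fun=> 0)) /= !mul0r ?mul1r ?addr0 ?add0r.
by rewrite ![_ * \prod_i _]mulrC.
Qed.

Lemma twisted_cycle_set0 : twisted_cycle set0 = 1.
Proof.
rewrite hev_set0 hev_twisted_cycle mul1r mul0r addr0 big1 // => i _.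
by rewrite /coupling mulr1 mulr0 addr0.
Qed.

(** With the point at l_e0 frozen to (P : Q), the row of l_e0 in [cycle_mx] is
    linear in its weights (s_e0, t_e0), so it can serve as the row of the hub
    for (s_e0, t_e0) = (x_hub, y_hub).  The row of the index l_e0 itself is
    then the corner entry, a linear form in (x, y) taking the value -1 at
    (P, Q): the sign compensates for the transposition of the two rows. *)
Lemma twisted_cycle_contraction (e0 : 'I_K) (P Q b c : F) : P * b + Q * c = 1 ->
  exists B C : 'M[F]_n, forall x y, x (lvert e0) = P -> y (lvert e0) = Q ->
    hev idfun twisted_cycle x y = hev idfun (mixed_minors B C) x y.
Proof.
move=> PQ1.
pose W : 'M[F]_K := cyclic_band (fun=> 1) (fun=> 1).
pose B : 'M[F]_n := block_mx (block_mx
  (\matrix_(i, j) (if i == e0 then P *+ (j == i) else W i j))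
  (\matrix_(i, j) (if i == e0 then Q *+ (j == i) else 0)) 0 1%:M) 0 0 (- b)%:M.
pose C : 'M[F]_n := block_mx (block_mx
  (\matrix_(i, j) (if i == e0 then P *+ (j == ord_pred i) else 0))
  (\matrix_(i, j) (if i == e0 then Q *+ (j == ord_pred i) else W i j))
  (- 1%:M) 0) 0 0 (- c)%:M.
exists (xrow (lvert e0) (hub K) B), (xrow (lvert e0) (hub K) C) => x y xP yQ.
pose sw f i : F := f (tperm (lvert e0) (hub K) i).
have swl f i : sw f (lvert i) = if i == e0 then f (hub K) else f (lvert i).
  rewrite /sw; case: eqP => [->|ie]; first by rewrite tpermL.
  by rewrite tpermD // eq_sym ?lvert_hub // (inj_eq (@lvert_inj _)); apply/eqP.
have swr f i : sw f (rvert i) = f (rvert i).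
  by rewrite /sw tpermD // ?lvert_rvert // eq_sym rvert_hub.
have swh f : sw f (hub K) = f (lvert e0) by rewrite /sw tpermR.
rewrite hev_mixed_minors hev_twisted_cycle.
have -> : pencil idfun (xrow (lvert e0) (hub K) B)
                       (xrow (lvert e0) (hub K) C) x y =
          xrow (lvert e0) (hub K) (pencil idfun B C (sw x) (sw y)).
  by apply/matrixP => i j; rewrite !mxE /sw tpermK.
pose s i := if i == e0 then x (hub K) else 1.
pose t i := if i == e0 then y (hub K) else 1.
have -> : pencil idfun B C (sw x) (sw y) = cycle_mx (cyclic_band s t) x y (- 1).
  apply/matrixP => i j; rewrite mxE /B /C /cycle_mx.
  elim/vert_ind: i => [i|i|]; elim/vert_ind: j => [j|j|];
    rewrite ?block_mxEul ?block_mxEur ?block_mxEdl ?block_mxEdr;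
    rewrite ?block_mxEul ?block_mxEur ?block_mxEdl ?block_mxEdr;
    rewrite ?swl ?swr ?swh !mxE /= ?mulr0 ?addr0 ?add0r ?mulrN ?mulr_natr //.
  - rewrite /s /t; case: (i =P e0) => [->|_]; rewrite ?xP ?mulr0 ?addr0 //.
    by rewrite !mulrnAr mulrDr !mulrnAr ![x _ * _]mulrC ![y _ * _]mulrC.
  - rewrite /s /t; case: (i =P e0) => [->|_]; rewrite ?yQ ?mulr0 ?add0r //.
    by rewrite !mulrnAr mulrDr !mulrnAr ![x _ * _]mulrC ![y _ * _]mulrC.
  by rewrite xP yQ !mulr1n -opprD PQ1.
rewrite xrowE det_mulmx det_perm odd_tperm lvert_hub /= expr1 det_cycle_mx_band //.
rewrite !mulrN1 mulN1r opprK; congr (_ * _ + _ * _).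
  by rewrite (bigD1 e0) //= /s eqxx big1 ?mulr1 // => i /negPf ->.
by rewrite (bigD1 e0) //= /t eqxx big1 ?mulr1 // => i /negPf ->.
Qed.

End TwistedCycle.

(** * A Pluecker relation *)

Section Plucker.
Variables (R : comNzRingType) (n : nat) (M : 'M[R]_n) (i1 i2 : 'I_n).
Hypothesis neq12 : i1 != i2.

Definition replace_rows (p q : 'I_n -> R) : 'M[R]_n :=
  \matrix_(i, j) (if i == i1 then p j else if i == i2 then q j else M i j).

Lemma det_replace_rows1 p q : \det (replace_rows p q) =
  \sum_j p j * cofactor (replace_rows (fun=> 0) q) i1 j.
Proof.
rewrite (expand_det_row _ i1); apply: eq_bigr => j _; rewrite mxE eqxx.
congr (_ * (_ * \det _)); apply/matrixP => i l.
by rewrite !mxE eq_sym (negPf (neq_lift i1 i)).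
Qed.

Lemma det_replace_rows2 p q : \det (replace_rows p q) =
  \sum_j q j * cofactor (replace_rows p (fun=> 0)) i2 j.
Proof.
rewrite (expand_det_row _ i2); apply: eq_bigr => j _.
rewrite mxE eq_sym (negPf neq12) eqxx.
congr (_ * (_ * \det _)); apply/matrixP => i l.
by rewrite !mxE [lift _ _ == i2]eq_sym (negPf (neq_lift i2 i)).
Qed.

(** By Cramer's rule det N * c is the combination of the rows of
    N = replace_rows a b whose coefficients are the determinants with one row
    replaced by c.  Substituting it in the first slot of replace_rows c d
    leaves only the terms of the rows a and b, since every other row of N is
    repeated. *)
Lemma plucker_replace_rows a b c d :
  \det (replace_rows a b) * \det (replace_rows c d) =
  \det (replace_rows c b) * \det (replace_rows a d) +
  \det (replace_rows a c) * \det (replace_rows b d).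
Proof.
set N := replace_rows a b; pose u i := \sum_j c j * cofactor N i j.
have u1 : u i1 = \det (replace_rows c b).
  rewrite det_replace_rows1; apply: eq_bigr => j _; congr (_ * (_ * \det _)).
  by apply/matrixP => i l; rewrite !mxE eq_sym (negPf (neq_lift i1 i)).
have u2 : u i2 = \det (replace_rows a c).
  rewrite det_replace_rows2; apply: eq_bigr => j _; congr (_ * (_ * \det _)).
  by apply/matrixP => i l; rewrite !mxE [lift _ _ == i2]eq_sym (negPf (neq_lift i2 i)).
have cramer j : \det N * c j = \sum_i u i * N i j.
  have /matrixP/(_ 0 j) := congr1 (mulmx (\row_l c l)) (mul_adj_mx N).
  rewrite mulmxA mul_mx_scalar !mxE => <-; apply: eq_bigr => i _; rewrite !mxE.
  by congr (_ * _); apply: eq_bigr => l _; rewrite !mxE.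
transitivity (\sum_i u i * \det (replace_rows (N i) d)).
  rewrite det_replace_rows1 mulr_sumr.
  under eq_bigr => j _ do rewrite mulrA cramer mulr_suml.
  rewrite exchange_big; apply: eq_bigr => i _ /=.
  by rewrite det_replace_rows1 mulr_sumr; apply: eq_bigr => j _; rewrite mulrA.
rewrite (bigD1 i1) //= (bigD1 i2) /=; last by rewrite eq_sym.
rewrite big1 ?addr0 => [|i /andP[i_1 i_2]].
  rewrite u1 u2; congr (_ * _ + _ * _); congr (\det _);
    apply/matrixP => i j; rewrite !mxE ?eqxx //.
  by rewrite [i2 == i1]eq_sym (negPf neq12).
rewrite (determinant_alternate (i1 := i1) (i2 := i)) ?mulr0 // 1?eq_sym // => j.
by rewrite !mxE eqxx (negPf i_1) (negPf i_2).
Qed.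

End Plucker.

(** * Multiaffine functions and the odd cycle *)

Section Vanishing.
Variables (F : fieldType) (n : nat).
Notation R := {mpoly F[n]}.
Implicit Types (w : 'I_n -> R) (G H : ('I_n -> R) -> R).

Definition update w i (c : R) : 'I_n -> R := fun l => if l == i then c else w l.

Definition multiaffine G :=
  forall w i, exists g0 g1, forall c, G (update w i c) = g0 + c * g1.

Definition subst_var (i j : 'I_n) : R -> R :=
  comp_mpoly [tuple (if l == i then 'X_j else 'X_l) | l < n].

(** With [multiaffine], this replaces the assumption that G is a polynomial in
    w with coefficients in F. *)
Definition substitutive G :=
  forall w i j, subst_var i j (G w) = G (subst_var i j \o w).

Definition extensional G := forall w w', w =1 w' -> G w = G w'.

Definition vars : 'I_n -> R := fun i => 'X_i.

(** Divisibility of G by X_i - X_j, in a form that needs no division. *)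
Definition vanishes_on G i j := G (update vars i 'X_j) == 0.

Lemma mpolyXU_inj (i j : 'I_n) : 'X_i = 'X_j :> R -> i = j.
Proof.
move/(congr1 (mcoeff U_(i)%MM)); rewrite !mcoeffXU eqxx; case: eqP => // _ /eqP.
by rewrite oner_eq0.
Qed.

Lemma vanishes_on_sym G i j : extensional G -> substitutive G ->
  vanishes_on G i j -> vanishes_on G j i.
Proof.
move=> extG subG /eqP Gij; rewrite /vanishes_on.
have := subG (update vars i 'X_j) j i; rewrite Gij /subst_var raddf0 => /esym.
rewrite (extG _ (update vars j 'X_i)) => [->//|l] /=; rewrite /update.
case: eqP => [->|_]; rewrite comp_mpolyXU -tnth_nth tnth_mktuple ?eqxx //.
by case: (i =P j) => [->|].
Qed.

(** An affine function of X_i with the two distinct roots X_j and X_j' is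
    zero. *)
Lemma vanishes_on_inj G i j j' : extensional G -> multiaffine G -> G vars != 0 ->
  vanishes_on G i j -> vanishes_on G i j' -> j = j'.
Proof.
move=> extG affG G0; have [g0 [g1 Gi]] := affG vars i.
rewrite /vanishes_on !Gi => /eqP Gj /eqP Gj'; apply/mpolyXU_inj/eqP.
rewrite -subr_eq0; have : ('X_j - 'X_j') * g1 = 0.
  by rewrite mulrBl -[X in X - _](addKr g0) Gj -[X in _ - X](addKr g0) Gj' subrr.
move/eqP; rewrite mulf_eq0 => /orP[//|/eqP g1_0].
move: Gj; rewrite g1_0 mulr0 addr0 => g0_0; case/eqP: G0.
rewrite (extG _ (update vars i 'X_i)); first by rewrite Gi g0_0 g1_0 mulr0 addr0.
by move=> l; rewrite /update; case: eqP => [->|].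
Qed.

End Vanishing.

Section OddCycle.
Variables (F : fieldType) (k : nat).
Notation K := k.+2.
Notation n := (K + K + 1)%N.
Notation R := {mpoly F[n]}.
Notation u := (fun e => lvert (inord e : 'I_K)).
Notation v := (fun e => rvert (inord e : 'I_K)).

(** The edges of the cycle r_0 l_1 r_1 l_2 .. l_(k+1) r_(k+1) of length
    2k + 3. *)
Definition cycle_edge (i j : 'I_n) : Prop :=
  [\/ exists2 e, (e <= k)%N & i = v e /\ j = u e.+1,
      exists2 e, (0 < e <= k.+1)%N & i = u e /\ j = v e |
      i = v k.+1 /\ j = v 0%N].

(** If r_0 l_1 is assigned to G, then all edges r_e l_(e+1) go to G and all
    edges l_e r_e go to H, as adjacent edges go to different functions.  The
    closing edge r_(k+1) r_0 is then adjacent to an edge of each kind. *)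
Lemma odd_cycle_first_edge (G H : ('I_n -> R) -> R) :
  extensional G -> extensional H -> substitutive G -> substitutive H ->
  multiaffine G -> multiaffine H -> G (@vars F n) != 0 -> H (@vars F n) != 0 ->
  (forall i j, cycle_edge i j -> vanishes_on G i j || vanishes_on H i j) ->
  ~~ vanishes_on G (v 0%N) (u 1%N).
Proof.
move=> eG eH sG sH aG aH G0 H0 edge; apply/negP => G01.
have v_inj e e' : (e <= k.+1)%N -> (e' <= k.+1)%N -> v e = v e' -> e = e'.
  by move=> ek e'k /rvert_inj /(congr1 val); rewrite /= !inordK.
have stepH e : (e <= k)%N -> vanishes_on G (v e) (u e.+1) ->
    vanishes_on H (v e.+1) (u e.+1).
  move=> ek /(vanishes_on_sym eG sG) Ge.
  have /edge/orP[G1|/(vanishes_on_sym eH sH) //] : cycle_edge (u e.+1) (v e.+1).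
    by constructor 2; exists e.+1.
  have /v_inj -/(_ (leqW ek) ek) := vanishes_on_inj eG aG G0 Ge G1.
  by move/eqP; rewrite ltn_eqF.
have G_all e : (e <= k)%N -> vanishes_on G (v e) (u e.+1).
  elim: e => [//|e IHe] ek; have He := stepH e (ltnW ek) (IHe (ltnW ek)).
  have /edge/orP[//|H1] : cycle_edge (v e.+1) (u e.+2) by constructor 1; exists e.+1.
  have /lvert_inj/(congr1 val) := vanishes_on_inj eH aH H0 He H1.
  by rewrite /= !inordK ?ltnS // 1?ltnW // => /eqP; rewrite ltn_eqF.
have Hlast := stepH k (leqnn k) (G_all k (leqnn k)).
have /edge/orP[G1|H1] : cycle_edge (v k.+1) (v 0%N) by constructor 3.
  have := vanishes_on_inj eG aG G0 G01 (vanishes_on_sym eG sG G1).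
  by move/eqP; rewrite lvert_rvert.
have := vanishes_on_inj eH aH H0 Hlast H1.
by move/eqP; rewrite lvert_rvert.
Qed.

Lemma odd_cycle_not_split (G H : ('I_n -> R) -> R) :
  extensional G -> extensional H -> substitutive G -> substitutive H ->
  multiaffine G -> multiaffine H -> G (@vars F n) != 0 -> H (@vars F n) != 0 ->
  ~ (forall i j, cycle_edge i j -> vanishes_on G i j || vanishes_on H i j).
Proof.
move=> eG eH sG sH aG aH G0 H0 edge.
have /edge : cycle_edge (v 0%N) (u 1%N) by constructor 1; exists 0%N.
rewrite (negPf (odd_cycle_first_edge eG eH sG sH aG aH G0 H0 edge)) /=.
apply/negP; apply: (odd_cycle_first_edge eH eG) => // i j /edge.
by rewrite orbC.
Qed.

End OddCycle.

(** * The twisted cycle is not a vector of principal minors *)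

Section AffineDeterminant.
Variables (F : fieldType) (n : nat) (alpha beta : 'M[F]_n).
Notation R := {mpoly F[n]}.

Definition affine_mx (w : 'I_n -> R) : 'M[R]_n :=
  \matrix_(i, j) ((alpha i j)%:MP + w i * (beta i j)%:MP).
Definition affine_det w : R := \det (affine_mx w).

Lemma affine_det_extensional : extensional affine_det.
Proof.
by move=> w w' e; congr (\det _); apply/matrixP => i j; rewrite !mxE e.
Qed.

Lemma affine_det_substitutive : substitutive affine_det.
Proof.
move=> w i j; rewrite /subst_var /affine_det -det_map_mx; congr (\det _).
by apply/matrixP => i' j'; rewrite !mxE rmorphD rmorphM /= !comp_mpolyC.
Qed.

Lemma affine_det_multiaffine : multiaffine affine_det.
Proof.
move=> w i; pose cof j := cofactor (affine_mx w) i j.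
exists (\sum_j (alpha i j)%:MP * cof j), (\sum_j (beta i j)%:MP * cof j) => c.
rewrite /affine_det (expand_det_row _ i) mulr_sumr -big_split /=.
apply: eq_bigr => j _; rewrite mxE /update eqxx mulrA -mulrDl; congr (_ * (_ * \det _)).
by apply/matrixP => i' j'; rewrite !mxE eq_sym (negPf (neq_lift i i')).
Qed.

End AffineDeterminant.

Section NotPrincipalMinors.
Variables (F : fieldType) (k : nat).
Hypothesis k_even : ~~ odd k.+1.
Notation K := k.+2.
Notation n := (K + K + 1)%N.
Notation R := {mpoly F[n]}.
Variable A : 'M[F]_n.
Hypothesis imA : principal_minor_map A = twisted_cycle F k.

Let l0 : 'I_n := lvert (ord0 : 'I_K).
Let right_side (i : 'I_n) := [exists e : 'I_K, i == rvert e].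

Let right_rvert e : right_side (rvert e).
Proof. by apply/existsP; exists e. Qed.

Let right_lvert e : right_side (lvert e) = false.
Proof. by apply/existsP => -[e']; rewrite lvert_rvert. Qed.

(** The rows of diag x + diag y A at the points (w_i : 1) on the left vertices
    and (1 : - w_i) on the right ones, where the coupling of l_i with r_j is
    w(l_i) - w(r_j). *)
Let alpha : 'M[F]_n := \matrix_(i, j) (if right_side i then (i == j)%:R else A i j).
Let beta : 'M[F]_n := \matrix_(i, j) (if right_side i then - A i j else (i == j)%:R).

(** The rows of l_0 and of the hub are replaced by p and q. *)
Let minor (p q : 'I_n -> F) (w : 'I_n -> R) : R :=
  affine_det (replace_rows alpha l0 (hub K) p q)
             (replace_rows beta l0 (hub K) (fun=> 0) (fun=> 0)) w.

Let minor_ext p q : extensional (minor p q).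
Proof. exact: affine_det_extensional. Qed.

Let minor_subst p q : substitutive (minor p q).
Proof. exact: affine_det_substitutive. Qed.

Let minor_multiaffine p q : multiaffine (minor p q).
Proof. exact: affine_det_multiaffine. Qed.

Let pt (b : bool) (i : 'I_n) : 'I_n -> F := if b then A i else 1%:M i.

Let minorE p q w : minor p q w =
  \det (replace_rows (affine_mx alpha beta w) l0 (hub K)
         (fun j => (p j)%:MP) (fun j => (q j)%:MP)).
Proof.
congr (\det _); apply/matrixP => i j; rewrite !mxE.
by case: ifP => _; [|case: ifP => _]; rewrite ?mpolyC0 ?mulr0 ?addr0.
Qed.

Let upath (w : 'I_n -> R) := \prod_(i : 'I_K | i != ord0) (w (lvert i) - w (rvert i)).
Let vpath (w : 'I_n -> R) :=
  \prod_(i : 'I_K | i != ord0) (w (lvert i) - w (rvert (ord_pred i))).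
Let rlast := rvert (ord_pred (ord0 : 'I_K)).
Let rfirst := rvert (ord0 : 'I_K).

Let minor_pt b0 bz w : minor (pt b0 l0) (pt bz (hub K)) w =
  (~~ bz)%:R * ((~~ b0)%:R - b0%:R * w rfirst) * upath w +
  bz%:R * ((~~ b0)%:R - b0%:R * w rlast) * vpath w.
Proof.
pose x i : R := if i == l0 then (~~ b0)%:R else if i == hub K then (~~ bz)%:R
                else if right_side i then 1 else w i.
pose y i : R := if i == l0 then b0%:R else if i == hub K then bz%:R
                else if right_side i then - w i else 1.
have -> : minor (pt b0 l0) (pt bz (hub K)) w =
          hev (@mpolyC n F) (twisted_cycle F k) x y.
  rewrite -imA principal_minorE hev_mixed_minors minorE; congr (\det _).
  apply/matrixP => i j; rewrite !mxE /x /y /pt /=.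
  case: eqP => [->|_]; first by case: (b0); rewrite ?mul1r ?mul0r ?addr0 ?add0r ?mxE.
  case: eqP => [->|_]; first by case: (bz); rewrite ?mul1r ?mul0r ?addr0 ?add0r ?mxE.
  case: ifP => _; rewrite ?mul1r // 1?addrC //.
  by rewrite addrC mpolyCN mulrN mulNr.
have xh : x (hub K) = (~~ bz)%:R by rewrite /x eq_sym lvert_hub eqxx.
have yh : y (hub K) = bz%:R by rewrite /y eq_sym lvert_hub eqxx.
have xr e : x (rvert e) = 1.
  by rewrite /x eq_sym lvert_rvert rvert_hub right_rvert.
have yr e : y (rvert e) = - w (rvert e).
  by rewrite /y eq_sym lvert_rvert rvert_hub right_rvert.
have c0 j : coupling x y ord0 j = (~~ b0)%:R - b0%:R * w (rvert j).
  by rewrite /coupling xr yr /x /y eqxx mulr1 mulrN.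
have cn i j : i != ord0 -> coupling x y i j = w (lvert i) - w (rvert j).
  move=> i0; rewrite /coupling xr yr /x /y (inj_eq (@lvert_inj _)) (negPf i0).
  by rewrite lvert_hub right_lvert mulr1 mul1r.
rewrite hev_twisted_cycle // xh yh (bigD1 ord0) //= c0.
rewrite [X in _ + _ * X](bigD1 ord0) //= c0 !mulrA.
by congr (_ * _ + _ * _); apply: eq_bigr => i i0; rewrite cn.
Qed.

Let G := minor (1%:M l0) (A l0).
Let H := minor (1%:M (hub K)) (A (hub K)).

(** Here [minor_pt] gives the four values with p in {e_0, A_0} and q in
    {e_hub, A_hub}; their 2 x 2 determinant loses l_0, leaving the factor
    between its two neighbours. *)
Let mulGH w : G w * H w = upath w * vpath w * (w rfirst - w rlast).
Proof.
have neq : l0 != hub K by rewrite lvert_hub.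
have := plucker_replace_rows (affine_mx alpha beta w) neq
  (fun j => (pt false l0 j)%:MP) (fun j => (pt false (hub K) j)%:MP)
  (fun j => (pt true l0 j)%:MP) (fun j => (pt true (hub K) j)%:MP).
rewrite -!minorE !minor_pt /= -/G -/H => e.
have -> : G w * H w = upath w * (- w rlast * vpath w) - (- w rfirst * upath w) * vpath w.
  by move: e; rewrite /G /H /pt; move: (minor _ _ w) (minor _ _ w) => g h e; ring: e.
by ring.
Qed.

Lemma twisted_cycle_not_principal_minors : False.
Proof.
have neqX (i j : 'I_n) : i != j -> ('X_i - 'X_j : R) != 0.
  by move=> ij; rewrite subr_eq0; apply: contraNneq ij => /mpolyXU_inj ->.
have GH0 : G (@vars F n) * H (@vars F n) != 0.
  rewrite mulGH !mulf_neq0 ?neqX ?(inj_eq (@rvert_inj _)) //.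
  - by apply/prodf_neq0 => i _; rewrite neqX ?lvert_rvert.
  - by apply/prodf_neq0 => i _; rewrite neqX ?lvert_rvert.
  - by rewrite -val_eqE /= modn_small.
move: GH0; rewrite mulf_eq0 => /norP[G0 H0].
apply: (odd_cycle_not_split (minor_ext _ _) (minor_ext _ _) (minor_subst _ _)
  (minor_subst _ _) (minor_multiaffine _ _) (minor_multiaffine _ _) G0 H0).
move=> i j edge; rewrite /vanishes_on -mulf_eq0 mulGH.
have upd_ij (a b : 'I_n) : a != b ->
    update (@vars F n) a 'X_b a - update (@vars F n) a 'X_b b = 0.
  by move=> ab; rewrite /update eqxx eq_sym (negPf ab) subrr.
have upd_ji (a b : 'I_n) : a != b ->
    update (@vars F n) a 'X_b b - update (@vars F n) a 'X_b a = 0.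
  by move=> ab; rewrite /update eqxx eq_sym (negPf ab) subrr.
case: edge => [[e ek [-> ->]]|[e /andP[e0 ek] [-> ->]]|[-> ->]].
- rewrite /vpath (bigD1 (inord e.+1)) /=; last by rewrite -val_eqE /= inordK.
  have -> : ord_pred (inord e.+1 : 'I_K) = inord e.
    apply: val_inj; rewrite /= inordK // inordK ?ltnS 1?leqW //.
    by rewrite addSn /= modnDr modn_small // ltnS leqW.
  by rewrite upd_ji ?mul0r ?mulr0 ?mul0r // eq_sym lvert_rvert.
- rewrite /upath (bigD1 (inord e)) /=; last by rewrite -val_eqE /= inordK // -lt0n.
  by rewrite upd_ij ?mul0r // lvert_rvert.
have -> : rfirst = rvert (inord 0 : 'I_K).
  by congr rvert; apply: val_inj; rewrite /= inordK.
have -> : rlast = rvert (inord k.+1 : 'I_K).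
  by congr rvert; apply: val_inj; rewrite /= inordK // modn_small.
rewrite upd_ji ?mulr0 // (inj_eq (@rvert_inj _)) -val_eqE /= !inordK //.
Qed.

End NotPrincipalMinors.

(** * Finitely many equations do not suffice *)

Lemma eval_widen_minorpoly (F : fieldType) N n (le_N_n : (N <= n)%N)
    (P : minorpoly F N) (a b : minorvec F n) :
  (forall T : {set 'I_N}, a (widen_set le_N_n T) = b (widen_set le_N_n T)) ->
  eval_minorpoly (widen_minorpoly le_N_n P) a =
  eval_minorpoly (widen_minorpoly le_N_n P) b.
Proof.
move=> ab; rewrite /eval_minorpoly /widen_minorpoly !comp_mpoly_meval.
by apply: meval_eq => j; rewrite !tnth_mktuple !mevalXU !enum_rankK.
Qed.

(** More left vertices than N: gam moves one of them out of [N], so it is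
    specialized, and there the twisted cycle becomes determinantal. *)
Lemma twisted_cycle_orbit (F : fieldType) N k (gam : SL2wr F (k.+2 + k.+2 + 1))
    (le_N_n : (N <= k.+2 + k.+2 + 1)%N) :
  ~~ odd k.+1 -> (N < k.+2)%N ->
  exists (A : 'M[F]_(k.+2 + k.+2 + 1)) (gam' : SL2wr F (k.+2 + k.+2 + 1)),
  forall T : {set 'I_N},
    SL2wr_act gam (twisted_cycle F k) (widen_set le_N_n T) =
    SL2wr_act gam' (principal_minor_map A) (widen_set le_N_n T).
Proof.
move=> k_even ltNk.
have [e0 Ne0] : exists e0 : 'I_k.+2, (N <= gam.2 (lvert e0))%N.
  apply/existsP; apply: contraLR ltNk; rewrite negb_exists => /forallP small.
  have lt e : (gam.2 (lvert e) < N)%N by rewrite ltnNge small.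
  pose f (e : 'I_k.+2) := Ordinal (lt e).
  have f_inj : injective f.
    by move=> e e' /(congr1 val) /= /val_inj /perm_inj /lvert_inj.
  rewrite -leqNgt -[X in (X <= _)%N]card_ord -[X in (_ <= X)%N]card_ord.
  exact: leq_card f f_inj.
set g := val (gam.1 (gam.2 (lvert e0))).
have PQ1 : g 0 0 * g 1 1 + g 1 0 * (- g 0 1) = 1.
  by rewrite -(eqP (valP (gam.1 (gam.2 (lvert e0))))) det_mx22 -/g mulrN [g 1 0 * _]mulrC.
have [B [C BC]] := twisted_cycle_contraction k_even e0 PQ1.
have [A [gam' AP]] := principal_minor_map_orbit_of_mixed_minors le_N_n B C Ne0.
exists A, gam' => T; rewrite -[RHS]AP !SL2wr_actE !ffunE.
by apply: BC; rewrite (negPf (notin_widen_set _ _ Ne0)).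
Qed.

Theorem theorem8p1 (F : fieldType) :
  ~ exists (N : nat) (Ps : seq (minorpoly F N)),
      (1 <= N)%N /\
      forall (n : nat) (le_N_n : (N <= n)%N) (a : minorvec F n),
        a set0 = 1 ->
        ((exists A : 'M[F]_n, principal_minor_map A = a) <->
         (forall P : minorpoly F N, P \in Ps ->
          forall gam : SL2wr F n,
            eval_minorpoly (widen_minorpoly le_N_n P) (SL2wr_act gam a) = 0)).
Proof.
move=> [N [Ps [_ cut]]]; pose k := (N.*2).+1.
have k_even : ~~ odd k.+1 by rewrite /= odd_double.
have ltNk : (N < k.+2)%N by rewrite /k -addnn -!addnS -[X in (X < _)%N]addn0 ltn_add2l.
have le_N_n : (N <= k.+2 + k.+2 + 1)%N.
  by apply: leq_trans (ltnW ltNk) _; rewrite -addnA leq_addr.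
have [|A] := iffRL (cut _ le_N_n _ (twisted_cycle_set0 F k_even)); last first.
  exact: twisted_cycle_not_principal_minors.
move=> P PsP gam; have [A [gam' eqA]] := twisted_cycle_orbit gam le_N_n k_even ltNk.
rewrite (eval_widen_minorpoly _ eqA).
have A0 : principal_minor_map A set0 = 1.
  rewrite principal_minorE ffunE -[RHS](det1 F (k.+2 + k.+2 + 1)%N); congr (\det _).
  by apply/matrixP => i j; rewrite !mxE inE.
by apply: (cut _ le_N_n _ A0).1 => //; exists A.
Qed.
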